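(* Let $\mathfrak{M}$ be a von Neumann algebra, let $A\in\mathfrak{M}$ be nonzero and positive, and let $\phi:\mathfrak{M}^A\to\mathbb{C}$ be a linear map. If $\phi(T)\in\sigma_A(T)$ for any $T\in\mathfrak{M}^A$, then $\phi(TS)=\phi(T)\phi(S)$ for any $S,T\in\mathfrak{M}^A$. In particular, if $A$ is in the center of $\mathfrak{M}$, then $\phi$ is a character.
   Context: $\mathfrak{M}$ acts on a complex Hilbert space $\mathcal{H}$ and contains the identity $I$. For $h\in\mathcal{H}$ put $\|h\|_A=\sqrt{\langle Ah,h\rangle}$, for $T\in\mathfrak{M}$ put $\|T\|_A=\sup\{\|Th\|_A:\|h\|_A=1\}$, and set $\mathfrak{M}^A=\{T\in\mathfrak{M}:\|T\|_A<\infty\}$ (a subalgebra of $\mathfrak{M}$; it equals $\mathfrak{M}$ when $A$ is central). $T\in\mathfrak{M}^A$ is $A$-invertible in $\mathfrak{M}^A$ if there is $S\in\mathfrak{M}^A$ with $ATS=AST=A$; the $A$-spectrum is $\sigma_A(T)=\{\lambda\in\mathbb{C}:\lambda I-T\text{ is not }A\text{-invertible in }\mathfrak{M}^A\}$. A character is a continuous (for the operator norm) multiplicative linear functional. *)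

(* Defs.v *)
From HB Require Import structures.
From mathcomp Require Import all_boot all_order all_algebra.
From mathcomp Require Import complex.
From mathcomp Require Import all_classical all_reals all_analysis.

Set Implicit Arguments.
Unset Strict Implicit.
Unset Printing Implicit Defensive.

Import Order.TTheory GRing.Theory Num.Theory.
Import numFieldNormedType.Exports.

Local Open Scope classical_set_scope.
Local Open Scope ring_scope.
Local Open Scope complex_scope.

(* A complex Hilbert space is a complete normed module H over R[i] with an
   inner product dot, linear in its first argument, that induces the norm:
   see hilbert_dot. Operators are functions H -> H with the pointwise vector
   space structure, and an operator algebra is a set of such functions. *)
Section operators.
Context {R : realType} {H : completeNormedModType R[i]}.
Variable dot : {dot H for (@Num.conj R[i])}.
Implicit Types (M D : set (H -> H)) (A T S : H -> H) (phi : (H -> H) -> R[i]).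

Definition hilbert_dot := forall h : H, `|h| ^+ 2 = dot h h.

Definition bounded_op T :=
  linear T /\ exists k : R, forall h, `|T h| <= k%:C * `|h|.

Definition is_adjoint T S := forall x y, dot (T x) y = dot x (S y).

(* Closure in the bounded operators for the weak operator topology, whose
   basic neighbourhoods of T are given by finitely many pairs (x i, y i) and a
   radius e; 0 < e in R[i] forces e to be real. *)
Definition wot_closure M : set (H -> H) := [set T | bounded_op T /\
  forall (n : nat) (x y : 'I_n -> H) (e : R[i]), 0 < e ->
    exists2 S, M S & forall i, `|dot (T (x i) - S (x i)) (y i)| < e].

Record von_neumann M : Prop := {
  vN_bounded : M `<=` bounded_op ;
  vN_id : M id ;
  vN_linear : forall (a : R[i]) T S, M T -> M S -> M (a *: T + S) ;
  vN_comp : forall T S, M T -> M S -> M (T \o S) ;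
  vN_adjoint : forall T, M T -> exists2 S, M S & is_adjoint T S ;
  vN_closed : wot_closure M `<=` M }.

Definition positive_op A := forall h, 0 <= dot (A h) h.

Definition central M A := M A /\ forall T, M T -> A \o T = T \o A.

(* For positive A the number dot (A h) h is real, so Re loses nothing. *)
Definition vnormA A (h : H) : R := Num.sqrt (complex.Re (dot (A h) h)).

Definition opnormA A T : \bar R :=
  ereal_sup [set (vnormA A (T h))%:E | h in [set h | vnormA A h = 1]].

Definition algA M A : set (H -> H) := [set T | M T /\ (opnormA A T < +oo)%E].

Definition invertibleA M A T :=
  exists2 S, algA M A S & A \o T \o S = A /\ A \o S \o T = A.

Definition spectrumA M A T : set R[i] :=
  [set l | ~ invertibleA M A (l *: (id : H -> H) - T)].

Definition opnorm T : \bar R :=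
  ereal_sup [set (complex.Re `|T h|)%:E | h in [set h : H | `|h| = 1]].

(* A functional on a set D of operators is a total function of which only the
   values on D matter. *)
Definition linear_on D phi := forall (a : R[i]) T S, D T -> D S ->
  phi (a *: T + S) = a * phi T + phi S.

Definition multiplicative_on D phi := forall T S, D T -> D S ->
  phi (T \o S) = phi T * phi S.

Definition opnorm_continuous_on D phi := forall T, D T ->
  forall e : R, 0 < e -> exists2 d : R, 0 < d &
    forall S, D S -> (opnorm (S - T)%R < d%:E)%E -> `|phi S - phi T| < e%:C.

Definition character D phi :=
  [/\ linear_on D phi, multiplicative_on D phi & opnorm_continuous_on D phi].

End operators.

(* Main.v *)
Require Import Defs.
From HB Require Import structures.
From mathcomp Require Import all_boot all_order all_algebra.
From mathcomp Require Import complex.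
From mathcomp Require Import all_classical all_reals all_analysis.
From mathcomp Require Import ring lra.
Set Implicit Arguments.
Unset Strict Implicit.
Unset Printing Implicit Defensive.

Import Order.TTheory GRing.Theory Num.Theory.
Import numFieldNormedType.Exports.
Local Open Scope classical_set_scope.
Local Open Scope ring_scope.
Local Open Scope complex_scope.

(** The functional [phi] is multiplicative for the reason behind the
    Gleason-Kahane-Zelazko theorem, in the polynomial form of Roitman and
    Sternfeld.  An operator that is invertible in M^A is A-invertible, so
    [phi] does not vanish on the invertible elements of M^A and [phi 1 = 1].
    Fix [T] in M^A and [n], and consider the polynomial
      p(z) = phi ((1 - z T)^n) = 1 - n phi(T) z + C(n,2) phi(T^2) z^2 - ...
    If p(z) = 0 then 1 - z T is not invertible, so 1/z is in the spectrum of
    T, which is bounded, by K say.  Hence p(z) is a product of at most n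
    factors 1 - a z with |a| <= K, and comparing the coefficients of z and z^2
    gives
      n^2 phi(T)^2 - n (n - 1) phi(T^2) = sum of the a^2,
    of modulus at most n K^2.  Dividing by n^2 and letting n grow,
    phi(T^2) = phi(T)^2 (lemma [spectral_functional_sqr]).  A linear functional
    that preserves squares is multiplicative, by polarization and the identity
    (ab - ba)^2 + (ab + ba)^2 = 2 (a(bab) + (bab)a)
    (theorem [gleason_kahane_zelazko]).

    The analytic input is that every T in M^A has bounded spectrum in M^A.
    When |l| exceeds the norm of T, the equation l x - T x = h is a fixed
    point problem for a contraction, so l - T is bijective; the iterates of
    the contraction are polynomials in T that converge to the inverse, which
    therefore lies in the weak operator closure M (lemma [resolvent_in]).  When
    |l| also exceeds the A-norm K of T, the triangle inequality
    ||(l - T) x||_A >= (|l| - K) ||x||_A shows that the inverse is in M^A.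

    When A is central, Reid's inequality gives M^A = M (lemma
    [central_boundedA]): with X = T^* T, the Cauchy-Schwarz inequality for the
    form <A x, y> bounds the square of ||X^(2^n) h||_A^2 by
    ||h||_A^2 ||X^(2^(n+1)) h||_A^2, and iterating this bounds ||X h||_A by a
    multiple of ||h||_A.  Then [resolvent_in] alone gives |phi(T)| <= ||T||,
    hence continuity. *)

(** * Polynomials with constant term one *)

Lemma coef_prod_one_sub (F : comNzRingType) (s : seq F)
    (p := \prod_(a <- s) (1 - a *: 'X)) :
  [/\ p`_0 = 1, p`_1 = - \sum_(a <- s) a &
      p`_2 *+ 2 = (\sum_(a <- s) a) ^+ 2 - \sum_(a <- s) a ^+ 2].
Proof.
rewrite {}/p; elim: s => [|a s [IH0 IH1 IH2]].
  by rewrite !big_nil !coef1 /= expr0n /= !(mul0rn, oppr0, addr0).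
rewrite !big_cons; set p := \prod_(_ <- _) _ in IH0 IH1 IH2 *.
have pE k : ((1 - a *: 'X) * p)`_k.+1 = p`_k.+1 - a * p`_k.
  by rewrite mulrBl mul1r -scalerAl coefB coefZ coefXM.
have p0 : ((1 - a *: 'X) * p)`_0 = p`_0.
  by rewrite mulrBl mul1r -scalerAl coefB coefZ coefXM mulr0 subr0.
rewrite p0 !pE IH0 IH1; split => //; first by ring.
by rewrite mulrnBl IH2; ring.
Qed.

(** Normalizing at 0 rather than at infinity turns the roots [z] into the
    numbers [a = z^-1], which stay bounded when the roots stay away from 0. *)
Lemma closed_poly_prod_one_sub (F : closedFieldType) (p : {poly F}) :
  p`_0 = 1 -> exists s : seq F,
  [/\ p = \prod_(a <- s) (1 - a *: 'X), (size s < size p)%N &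
      forall a, a \in s -> a != 0 /\ root p a^-1].
Proof.
move=> p0; have [r pE] := closed_field_poly_normal p.
have pn0 : p != 0.
  by apply: contra_eq_neq p0 => ->; rewrite coef0 eq_sym oner_eq0.
have rootE z : (root p z) = (z \in r).
  by rewrite pE rootZ ?lead_coef_eq0 // root_prod_XsubC.
have r0 z : z \in r -> z != 0.
  rewrite -rootE; apply: contraTneq => ->.
  by rewrite /root horner_coef0 p0 oner_eq0.
exists [seq z^-1 | z <- r]; split.
- rewrite big_map; have pC : lead_coef p * \prod_(z <- r) (- z) = 1.
    move: p0; rewrite {1}pE coefZ -horner_coef0 horner_prod => p0'.
    rewrite -[RHS]p0'; congr (_ * _); apply: eq_bigr => z _.
    by rewrite !hornerE.
  rewrite {1}pE -[RHS]scale1r -pC -scalerA; congr (_ *: _).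
  rewrite -scaler_prod big_seq [RHS]big_seq; apply: eq_bigr => z /r0 z0.
  rewrite scalerBr scalerA mulNr divff // scaleN1r opprK addrC.
  by rewrite alg_polyC polyCN.
- rewrite size_map pE size_scale ?lead_coef_eq0 // size_prod_XsubC //.
- by move=> _ /mapP[z zr ->]; rewrite invr_eq0 r0 // invrK rootE.
Qed.

(** * The Gleason-Kahane-Zelazko theorem *)

Definition invertible (B : pzRingType) (T : B) :=
  exists S, T * S = 1 /\ S * T = 1.

Lemma invertible_pow (B : pzRingType) (T : B) n :
  invertible T -> invertible (T ^+ n).
Proof.
move=> [S [TS ST]]; have TS_comm : GRing.comm T S by rewrite /GRing.comm TS ST.
by exists (S ^+ n); rewrite -!exprMn_comm // TS ST !expr1n.
Qed.

Lemma invertibleZ (F : fieldType) (B : algType F) (z : F) (T : B) :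
  z != 0 -> invertible T -> invertible (z *: T).
Proof.
move=> z0 [S [TS ST]]; exists (z^-1 *: S).
by rewrite -!scalerAl -!scalerAr !scalerA TS ST divff // mulVf // scale1r.
Qed.

Lemma complex_archi_eq0 (R : realType) (D K : R[i]) :
  (forall n, n%:R * `|D| <= K) -> D = 0.
Proof.
move=> le_nK; apply/eqP; rewrite -normr_eq0.
have DE : `|D| = (complex.Re `|D|)%:C by rewrite RRe_real // normr_real.
have K0 : 0 <= K by have := le_nK 0; rewrite mul0r.
have KE : K = (complex.Re K)%:C by rewrite RRe_real // ger0_real.
move: DE KE; set d := complex.Re _; set k := complex.Re _ => DE KE.
apply/negP => /negP d0; have {}d0 : 0 < d.
  by rewrite -ltcR -DE lt_def normr_ge0 d0.
have := le_nK (Num.bound (k / d)); rewrite DE KE -(rmorph_nat (real_complex R)).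
rewrite -rmorphM lecR -ler_pdivlMr // leNgt archi_boundP //.
by rewrite divr_ge0 ?(ltW d0) // -ler0c -KE.
Qed.

Section gleason_kahane_zelazko.
(* The topology of the algebra enters only through the boundedness of the
   spectra, which makes the argument purely algebraic. *)
Context {R : realType} {B : algType R[i]}.
Variable phi : {scalar B}.
Hypothesis phi_spec : forall T, ~ invertible (phi T *: 1 - T).
Hypothesis bounded_spec : forall T : B, exists K : R[i],
  forall l, ~ (`|l| <= K) -> invertible (l *: 1 - T).

Lemma spectral_functional1 : phi 1 = 1.
Proof.
apply: contrapT => phi1; apply: (@phi_spec 1).
rewrite -[X in _ - X]scale1r -scalerBl; apply: invertibleZ.
  by rewrite subr_eq0; apply/eqP.
by exists 1; rewrite mulr1.
Qed.

Lemma spectral_functional_neq0 T : invertible T -> phi T <> 0.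
Proof.
move=> Tinv phiT; apply: (@phi_spec T); rewrite phiT scale0r sub0r -scaleN1r.
by apply: invertibleZ; rewrite // oppr_eq0 oner_eq0.
Qed.

Lemma functional_expansion T n z : phi ((1 - z *: T) ^+ n) =
  (\poly_(k < n.+1) (phi (T ^+ k) * (-1) ^+ k *+ 'C(n, k))).[z].
Proof.
rewrite exprBn_comm; last exact/commr_sym/commr1.
rewrite linear_sum horner_poly; apply: eq_bigr => k _ /=.
have -> : (-1) ^+ k * 1 ^+ (n - k) * (z *: T) ^+ k
    = ((-1) ^+ k * z ^+ k) *: T ^+ k.
  rewrite expr1n mulr1 exprZn -scalerA -signr_odd -[in RHS]signr_odd.
  by case: odd; rewrite ?mulN1r ?mul1r ?scaleN1r ?scale1r.
by rewrite linearMn linearZ /= mulrnAl; congr (_ *+ _); ring.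
Qed.

(** The reciprocal roots of [z |-> phi ((1 - z T)^n)] lie in the spectrum of
    [T]; their first two power sums are [n phi(T)] and
    [n^2 phi(T)^2 - n (n - 1) phi(T^2)].  The latter is O(n) because the
    spectrum is bounded, which forces the coefficient of [n^2] to vanish. *)
Lemma spectral_functional_sqr T : phi (T ^+ 2) = phi T ^+ 2.
Proof.
have [K KP] := bounded_spec T.
have K0 : 0 <= K.
  apply: contrapT => K0; apply: (@phi_spec T); apply: KP => phiK.
  by apply: K0; apply: le_trans phiK.
apply/eqP; rewrite eq_sym -subr_eq0; apply/eqP.
apply: (@complex_archi_eq0 _ _ (K ^+ 2 + `|phi (T ^+ 2)|)).
case=> [|n]; first by rewrite mul0r addr_ge0 ?exprn_ge0.
set N := n.+1.
pose p := \poly_(k < N.+1) (phi (T ^+ k) * (-1) ^+ k *+ 'C(N, k)).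
have pE k : (k <= N)%N -> p`_k = phi (T ^+ k) * (-1) ^+ k *+ 'C(N, k).
  by rewrite coef_poly ltnS => ->.
have p0 : p`_0 = 1.
  by rewrite pE // expr0 bin0 mulr1n mulr1 spectral_functional1.
have [s [ps size_s sP]] := closed_poly_prod_one_sub p0.
have sK a : a \in s -> `|a| <= K.
  move=> /sP[a0]; rewrite /root -functional_expansion => /eqP.
  apply: contraPP => aK.
  apply/spectral_functional_neq0/invertible_pow.
  have -> : 1 - a^-1 *: T = a^-1 *: (a *: 1 - T).
    by rewrite scalerBr scalerA mulVf // scale1r.
  by apply: invertibleZ (KP _ aK); rewrite invr_eq0.
have [_ p1 p2] := coef_prod_one_sub s; rewrite -ps in p1 p2.
have sum1 : \sum_(a <- s) a = N%:R * phi T.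
  apply: oppr_inj; rewrite -p1 pE // bin1 !expr1 mulrN1 mulNrn.
  by rewrite mulr_natl.
have sum2 : p`_2 *+ 2 = N%:R * (N%:R - 1) * phi (T ^+ 2).
  case: (leqP 2 N) => [N2|]; last first.
    move=> N1; rewrite coef_poly ltnS leqNgt N1 mul0rn.
    have -> : N = 1%N by apply/eqP; rewrite eqn_leq -ltnS N1.
    by rewrite subrr mulr0 mul0r.
  rewrite pE // sqrrN expr1n mulr1 -mulrnA.
  have <- : (N ^_ 2)%N = ('C(N, 2) * 2)%N by rewrite -bin_ffact.
  by rewrite !ffactnS ffactn0 muln1 -[LHS]mulr_natl natrM -subn1 natrB.
have size_sN : (size s <= N)%N by rewrite -ltnS (leq_trans size_s) // size_poly.
have le_sum : `|\sum_(a <- s) a ^+ 2| <= N%:R * K ^+ 2.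
  apply: le_trans (ler_norm_sum _ _ _) _.
  rewrite big_seq; apply: (@le_trans _ _ (\sum_(a <- s) K ^+ 2)).
    rewrite [leRHS]big_seq; apply: ler_sum => a /sK aK.
    by rewrite normrX lerXn2r // nnegrE.
  rewrite big_const_seq count_predT iter_addr_0 -[leLHS]mulr_natl.
  by rewrite ler_wpM2r ?exprn_ge0 // ler_nat.
have N_gt0 : 0 < N%:R :> R[i] by rewrite ltr0n.
rewrite -(ler_pM2l N_gt0) mulrDr -lerBlDr.
apply: le_trans le_sum.
have -> : \sum_(a <- s) a ^+ 2 =
    N%:R * (N%:R * (phi T ^+ 2 - phi (T ^+ 2))) + N%:R * phi (T ^+ 2).
  transitivity (p`_2 *+ 2 * -1 + (\sum_(a <- s) a) ^+ 2).
    by rewrite p2; ring.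
  by rewrite sum2 sum1; ring.
rewrite -[in leLHS](ger0_norm (ltW N_gt0)) -!normrM.
by exact: lerB_normD.
Qed.

Theorem gleason_kahane_zelazko S T : phi (S * T) = phi S * phi T.
Proof.
have jordan a b : phi (a * b) + phi (b * a) = 2 * phi a * phi b.
  have := spectral_functional_sqr (a + b).
  rewrite expr2 mulrDl !mulrDr !linearD -!expr2 !spectral_functional_sqr => h.
  move/eqP: h; rewrite -subr_eq0 => /eqP h; apply/eqP; rewrite -subr_eq0 -h.
  by apply/eqP; ring.
have mul0 a b : phi a = 0 -> phi (a * b) = 0.
  move=> a0.
  (* With c = bab, phi (ac + ca) = 0, so the images of (ab + ba)^2 and
     (ab - ba)^2, namely 0 and 4 phi(ab)^2, add up to 0. *)
  have anti : phi (b * a) = - phi (a * b).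
    by apply/eqP; rewrite -addr_eq0 addrC jordan a0 mulr0 mul0r.
  have := jordan a (b * a * b); rewrite a0 mulr0 mul0r => h.
  have := spectral_functional_sqr (a * b - b * a).
  have := spectral_functional_sqr (a * b + b * a).
  rewrite !expr2 !(mulrDl, mulrDr, mulrN, mulNr, opprK) !(linearD, linearN) /=.
  rewrite !anti !mulrA in h *; move: h.
  set u := phi (a * b); set c1 := phi (a * b * a * b).
  set c2 := phi (b * a * b * a); set c3 := phi (a * b * b * a).
  set c4 := phi (b * a * a * b) => c12 c1234 eq_u.
  have : 4 * u ^+ 2 = 0.
    transitivity ((u - - u) * (u - - u)); first by ring.
    transitivity (2 * (c1 + c2) - (c1 + c3 + (c4 + c2))); last first.
      by rewrite c12 c1234; ring.
    by rewrite -eq_u; ring.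
  by move/eqP; rewrite mulf_eq0 pnatr_eq0 /= expf_eq0 => /eqP.
(* Splitting off the scalar part of S reduces to the case phi S = 0. *)
rewrite -[in LHS](subrK (phi S *: 1) S) mulrDl linearD /= mul0; last first.
  by rewrite linearB linearZ /= spectral_functional1 mulr1 subrr.
by rewrite add0r -scalerAl mul1r linearZ.
Qed.
End gleason_kahane_zelazko.

(** * Algebras of operators *)

(** Trades a function that is linear for a bundled linear map, to which the
    generic rewriting lemmas for linear maps apply. *)
Lemma linear_mapE (K : pzRingType) (V W : lmodType K) (T : V -> W) :
  linear T -> exists f : {linear V -> W}, T = f.
Proof.
move=> Tlin.
pose f : {linear V -> W} := HB.pack T (GRing.isLinear.Build K V W *:%R T Tlin).
by exists f.
Qed.

(** The condition [opalg_id_neq0] excludes the zero space, on which operators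
    would form the zero ring. *)
Record operator_algebra (K : comNzRingType) (V : lmodType K)
    (E : set (V -> V)) : Prop := {
  opalg_linear : forall T, E T -> linear T ;
  opalg_id : E id ;
  opalg_id_neq0 : (id : V -> V) <> 0 ;
  opalg_lincomb : forall (a : K) T S, E T -> E S -> E (a *: T + S) ;
  opalg_comp : forall T S, E T -> E S -> E (T \o S) }.

Section operator_algebra_type.
Context {K : comNzRingType} {V : lmodType K} {E : set (V -> V)}.

(** Depends on the proof [hE] so that the ring structure given by composition
    can be attached to this type. *)
Definition opalg (hE : operator_algebra E) := {T : V -> V | `[<E T>]}.

Variable hE : operator_algebra E.
Local Notation B := (opalg hE).
HB.instance Definition _ := gen_eqMixin B.
HB.instance Definition _ := gen_choiceMixin B.

Definition opalg_of (T : V -> V) (ET : E T) : B := exist _ T (asboolT ET).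
Definition opfun (T : B) : V -> V := sval T.

Lemma opfunP T : E (opfun T). Proof. exact/asboolP/(svalP T). Qed.

Lemma opfun_inj : injective opfun.
Proof.
by move=> [T ET] [S ES] TS; apply: eq_exist; exact: TS.
Qed.

Let E0 : E 0.
Proof.
have := opalg_lincomb hE (-1) (opalg_id hE) (opalg_id hE).
by rewrite scaleN1r addNr.
Qed.

Let EZ a T : E T -> E (a *: T).
Proof. by move=> ET; rewrite -[_ *: _]addr0; apply: (opalg_lincomb hE). Qed.

Let ED T S : E T -> E S -> E (T + S).
Proof. by move=> ET ES; rewrite -[T]scale1r; apply: (opalg_lincomb hE). Qed.

Definition op0 : B := opalg_of E0.
Definition op1 : B := opalg_of (opalg_id hE).
Definition opadd (T S : B) : B := opalg_of (ED (opfunP T) (opfunP S)).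
Definition opscale (a : K) (T : B) : B := opalg_of (EZ a (opfunP T)).
Definition opmul (T S : B) : B :=
  opalg_of (opalg_comp hE (opfunP T) (opfunP S)).

Let opaddA : associative opadd.
Proof. by move=> S T U; apply: opfun_inj; apply: addrA. Qed.
Let opaddC : commutative opadd.
Proof. by move=> S T; apply: opfun_inj; apply: addrC. Qed.
Let opadd0 : left_id op0 opadd.
Proof. by move=> S; apply: opfun_inj; apply: add0r. Qed.
Let opaddN : left_inverse op0 (opscale (-1)) opadd.
Proof.
move=> S; apply: opfun_inj; rewrite /opfun /=.
by rewrite [X in X + _]scaleN1r; apply: addNr.
Qed.
HB.instance Definition _ := GRing.isZmodule.Build B opaddA opaddC opadd0 opaddN.

Let opmulA : associative opmul.
Proof. by move=> S T U; apply: opfun_inj; rewrite /opfun. Qed.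
Let opmul1 : left_id op1 opmul.
Proof. by move=> S; apply: opfun_inj. Qed.
Let op1mul : right_id op1 opmul.
Proof. by move=> S; apply: opfun_inj. Qed.
Let opmulDl : left_distributive opmul opadd.
Proof. by move=> S T U; apply: opfun_inj; rewrite /opfun. Qed.
Let opmulDr : right_distributive opmul opadd.
Proof.
move=> S T U; apply: opfun_inj; apply/funext => x; rewrite /opfun /=.
by have [f ->] := linear_mapE (opalg_linear hE (opfunP S)); rewrite linearD.
Qed.
Let op1_neq0 : op1 != op0.
Proof. by apply/eqP => /(congr1 opfun); exact: (opalg_id_neq0 hE). Qed.
HB.instance Definition _ :=
  GRing.Zmodule_isNzRing.Build B opmulA opmul1 op1mul opmulDl opmulDr op1_neq0.

Let opscaleA a b T : opscale a (opscale b T) = opscale (a * b) T.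
Proof. by apply: opfun_inj; apply: scalerA. Qed.
Let opscale1 : left_id 1 opscale.
Proof. by move=> T; apply: opfun_inj; apply: scale1r. Qed.
Let opscaleDr : right_distributive opscale +%R.
Proof. by move=> a T S; apply: opfun_inj; apply: scalerDr. Qed.
Let opscaleDl T : {morph opscale^~ T : a b / a + b}.
Proof. by move=> a b; apply: opfun_inj; apply: scalerDl. Qed.
HB.instance Definition _ := GRing.Zmodule_isLmodule.Build K B
  opscaleA opscale1 opscaleDr opscaleDl.

Let opscaleAl (a : K) (T S : B) : a *: (T * S) = (a *: T) * S.
Proof. by apply: opfun_inj. Qed.
HB.instance Definition _ := GRing.Lmodule_isLalgebra.Build K B opscaleAl.

Let opscaleAr (a : K) (T S : B) : a *: (T * S) = T * (a *: S).
Proof.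
apply: opfun_inj; apply/funext => x; rewrite /opfun /=.
by have [f ->] := linear_mapE (opalg_linear hE (opfunP T)); rewrite linearZ.
Qed.
HB.instance Definition _ := GRing.Lalgebra_isAlgebra.Build K B opscaleAr.

End operator_algebra_type.

Definition inverse_in (V : Type) (E : set (V -> V)) T :=
  exists2 S, E S & T \o S = id /\ S \o T = id.

Theorem gkz_operators (R : realType) (V : lmodType R[i]) (E : set (V -> V))
    (phi : (V -> V) -> R[i]) : operator_algebra E ->
  (forall a T S, E T -> E S -> phi (a *: T + S) = a * phi T + phi S) ->
  (forall T, E T -> ~ inverse_in E (phi T *: (id : V -> V) - T)) ->
  (forall T, E T -> exists K : R[i], forall l, ~ (`|l| <= K) ->
     inverse_in E (l *: (id : V -> V) - T)) ->
  forall T S, E T -> E S -> phi (T \o S) = phi T * phi S.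
Proof.
move=> hE phi_lin phi_spec bdd.
pose B : algType R[i] := opalg hE.
pose psi0 (T : B) := phi (opfun T).
have psi0_lin : scalar psi0.
  by move=> a T S; apply: phi_lin; exact: opfunP.
pose psi : {scalar B} :=
  HB.pack psi0 (GRing.isLinear.Build _ _ _ _ psi0 psi0_lin).
have inv_opfun (T : B) l : invertible (l *: 1 - T) <->
    inverse_in E (l *: (id : V -> V) - opfun T).
  have funE : opfun (l *: 1 - T) = l *: (id : V -> V) - opfun T.
    by rewrite -[in RHS]scaleN1r.
  rewrite -funE; set U := _ - _; split.
    move=> [S [/(congr1 (@opfun _ _ _ hE)) US]].
    move=> /(congr1 (@opfun _ _ _ hE)) SU.
    by exists (opfun S) => //; exact: opfunP.
  move=> [S ES [US SU]]; exists (opalg_of hE ES).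
  by split; apply: opfun_inj.
move=> T S ET ES.
apply: (@gleason_kahane_zelazko R B psi _ _ (opalg_of hE ET) (opalg_of hE ES)).
  by move=> U /inv_opfun; apply: phi_spec; exact: opfunP.
move=> U; have [K KP] := bdd _ (opfunP U); exists K => l lK.
exact/inv_opfun/KP.
Qed.

(** * Contractions of complex normed spaces *)

(** Norms of vectors over [R[i]] are complex numbers; this moves them to [R],
    where the order is total and archimedean. *)
Lemma ge0_RRe (R : rcfType) (x : R[i]) : 0 <= x -> x = (complex.Re x)%:C.
Proof. by move=> x0; rewrite RRe_real // ger0_real. Qed.

Lemma expr_mul_small_real (R : realType) (q b e : R) :
  0 <= q -> q < 1 -> 0 < e -> exists n, q ^+ n * b < e.
Proof.
move=> q0 q1 e0.
have : (fun n => q ^+ n * b) @ \oo --> (0 * b : R).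
  by apply: cvgMl; apply: cvg_expr; rewrite ger0_norm.
rewrite mul0r => /cvgrPdist_lt /(_ _ e0)[n _ /(_ n (leqnn n))] /=.
by rewrite sub0r normrN => qe; exists n; apply: le_lt_trans (ler_norm _) qe.
Qed.

Lemma expr_mul_small (R : realType) (q : R) (b e : R[i]) :
  0 <= q -> q < 1 -> 0 <= b -> 0 < e -> exists n, q%:C ^+ n * b < e.
Proof.
move=> q0 q1 /ge0_RRe bE e0; have eE := ge0_RRe (ltW e0).
have [|n qe] := expr_mul_small_real (complex.Re b) q0 q1 (_ : 0 < complex.Re e).
  by rewrite -ltcR -eE.
by exists n; rewrite bE eE -rmorphXn -rmorphM ltcR.
Qed.

Lemma iter_contraction (R : realType) (H : normedModType R[i]) (f : H -> H)
    (q : R) : 0 <= q -> (forall x y, `|f x - f y| <= q%:C * `|x - y|) ->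
  forall n x y, `|iter n f x - iter n f y| <= q%:C ^+ n * `|x - y|.
Proof.
move=> q0 fq; elim=> [|n IH] x y; first by rewrite mul1r.
rewrite !iterS exprS -mulrA; apply: le_trans (fq _ _) _.
by rewrite ler_wpM2l // ler0c.
Qed.

Lemma contraction_fixpoint (R : realType) (H : completeNormedModType R[i])
    (f : H -> H) (q : R) : 0 <= q -> q < 1 ->
  (forall x y, `|f x - f y| <= q%:C * `|x - y|) -> exists x, f x = x.
Proof.
move=> q0 q1 fq; pose u n := iter n f 0.
have q1' : 0 < 1 - q%:C by rewrite subr_gt0 ltcR.
pose b := `|f 0| / (1 - q%:C).
have b0 : 0 <= b by rewrite divr_ge0 // ltW.
(* The ball of radius b = |f 0| / (1 - q) is stable under f, so the
   iterates from rank n on are within q^n b of the one of rank n. *)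
have ub n : `|u n| <= b.
  elim: n => [|n IH]; first by rewrite /u /= normr0.
  rewrite /u iterS -[X in `|X|](subrK (f 0)); apply: le_trans (ler_normD _ _) _.
  have -> : b = q%:C * b + `|f 0|.
    by rewrite -[X in _ + X](divfK (lt0r_neq0 q1')) -/b; ring.
  rewrite lerD2r; apply: le_trans (fq _ _) _.
  by rewrite subr0 ler_wpM2l // ler0c.
have uN n m : `|u n - u (m + n)%N| <= q%:C ^+ n * b.
  rewrite /u addnC iterD; apply: le_trans (iter_contraction q0 fq n _ _) _.
  rewrite sub0r normrN; apply: ler_wpM2l; last exact: ub.
  by rewrite exprn_ge0 // ler0c.
have /cauchy_cvgP cu : cauchy (u @ \oo).
  apply: cauchy_exP => e e0.
  have [n ne] := expr_mul_small q0 q1 b0 e0.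
  exists (u n); exists n => // m /= nm; rewrite -ball_normE /=.
  by rewrite -(subnK nm); apply: le_lt_trans (uN _ _) ne.
exists (lim (u @ \oo)); set x := lim _.
apply: contrapT => fx; have fx0 : 0 < `|f x - x| / 2.
  by rewrite divr_gt0 // normr_gt0 subr_eq0; apply/eqP.
have /cvgrPdist_lt /(_ _ fx0)[n _ un] : u n @[n --> \oo] --> x by [].
have : `|f x - x| < `|f x - x|; last by rewrite ltxx.
rewrite {1}(_ : f x - x = (f x - u n.+1) - (x - u n.+1)); last first.
  by rewrite opprB addrA subrK.
apply: le_lt_trans (ler_normB _ _) _; rewrite [ltRHS](splitr `|f x - x|).
apply: ler_ltD; last exact: un (leqnSn n).
rewrite /u iterS; apply: le_trans (fq _ _) _.
apply: le_trans (ltW (un n (leqnn n))).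
by rewrite ler_piMl // -(rmorph1 (real_complex R)) lecR ltW.
Qed.

(** * Positive sesquilinear forms *)

Lemma norm_real_complex (R : rcfType) (r : R) : `|r%:C| = `|r|%:C.
Proof. by rewrite normc_def /= expr0n /= addr0 sqrtr_sqr. Qed.

Section positive_form.
Context {R : realType} {V : lmodType R[i]}.
Variable f : V -> V -> R[i].
Hypothesis form_linl : forall a x y z, f (a *: x + y) z = a * f x z + f y z.
Hypothesis form_linr : forall a x y z,
  f x (a *: y + z) = Num.conj a * f x y + f x z.
Hypothesis form_ge0 : forall x, 0 <= f x x.

(** Polarization: the form is real at [x + y] and at ['i x + y], which makes
    the imaginary parts of [f x y] and [f y x] opposite and the real parts
    equal. *)
Lemma positive_form_hermitian x y : f y x = Num.conj (f x y).
Proof.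
have e1 : complex.Im (f (1 *: x + y) (1 *: x + y)) = 0 by exact: ger0_Im.
have e2 : complex.Im (f ('i *: x + y) ('i *: x + y)) = 0 by exact: ger0_Im.
move: e1 e2; rewrite !form_linl !form_linr rmorph1 !mul1r.
have := ger0_Im (form_ge0 x); have := ger0_Im (form_ge0 y).
case: (f x x) => r1 s1; case: (f y y) => r2 s2 /= -> ->.
case: (f x y) => a1 b1; case: (f y x) => a2 b2.
have -> : Num.conj ('i : R[i]) = 0 -i* 1 by [].
simpc => /= e1 e2; apply/eqP; rewrite eq_complex /=.
by apply/andP; split; apply/eqP; lra.
Qed.

Definition form_sqr x : R := complex.Re (f x x).

Lemma form_sqrE x : f x x = (form_sqr x)%:C.
Proof. exact/ge0_RRe. Qed.

Lemma form_sqr_ge0 x : 0 <= form_sqr x.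
Proof. by rewrite -ler0c -form_sqrE. Qed.

Lemma form_sqr_lincomb a x y : form_sqr (a *: x + y) =
  complex.Re `|a| ^+ 2 * form_sqr x + 2 * complex.Re (a * f x y) + form_sqr y.
Proof.
apply: complexI; rewrite -form_sqrE !form_linl !form_linr.
rewrite (positive_form_hermitian x y) !form_sqrE.
rewrite !(rmorphD, rmorphM, rmorphXn) /= -(ge0_RRe (normr_ge0 a)) -expr2 normCK.
have conjM : conjc (a * f x y) = Num.conj a * Num.conj (f x y).
  by rewrite -[LHS]/(Num.conj (a * f x y)) rmorphM.
have := addcJ (a * f x y); rewrite conjM rmorph1 => addJ.
transitivity (a * Num.conj a * (form_sqr x)%:C +
    2 * (complex.Re (a * f x y))%:C + (form_sqr y)%:C); last by ring.
by rewrite -addJ; ring.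
Qed.

(** The form may be degenerate, so the quadratic polynomial in [t] given by the
    square of [x - t f(x,y) y] is examined also when its leading coefficient
    vanishes. *)
Lemma form_cauchy_schwarz x y :
  `|f x y| ^+ 2 <= (form_sqr x * form_sqr y)%:C.
Proof.
have mE := @ge0_RRe _ (`|f x y| ^+ 2) (exprn_ge0 _ (normr_ge0 _)).
move: mE; set m := complex.Re _ => mE; rewrite mE lecR.
have m0 : 0 <= m by rewrite -ler0c -mE exprn_ge0.
have p0 := form_sqr_ge0 x; have a0 := form_sqr_ge0 y.
have key (t : R) : 0 <= form_sqr x - 2 * t * m + t ^+ 2 * m * form_sqr y.
  pose c := (- t)%:C * Num.conj (f y x).
  have := form_sqr_ge0 (c *: y + x).
  rewrite form_sqr_lincomb.
  have nE : `|f y x| ^+ 2 = m%:C.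
    by rewrite (positive_form_hermitian x y) norm_conjC.
  have -> : complex.Re `|c| ^+ 2 = t ^+ 2 * m.
    apply: complexI; rewrite rmorphXn /= -(ge0_RRe (normr_ge0 c)).
    rewrite normrM norm_conjC.
    rewrite exprMn nE norm_real_complex -rmorphXn real_normK ?num_real //.
    by rewrite sqrrN [RHS]rmorphM.
  have -> : c * f y x = (- t * m)%:C.
    by rewrite /c -mulrA (mulrC (Num.conj _)) -normCK nE rmorphM.
  by move=> /=; lra.
have [a_gt0|] := ltrP 0 (form_sqr y).
  have := key (form_sqr y)^-1.
  rewrite -(ler_pM2r a_gt0) mul0r !mulrDl.
  rewrite (_ : _ + _ = form_sqr x * form_sqr y - m) ?subr_ge0 //.
  by field; rewrite lt0r_neq0.
move=> a_le0; have aE : form_sqr y = 0 by apply/le_anti; rewrite a_le0.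
rewrite aE mulr0 leNgt; apply/negP => m_gt0.
have := key ((form_sqr x + 1) / m); rewrite aE mulr0 addr0.
rewrite (_ : _ - _ = - form_sqr x - 2); first by lra.
by field; rewrite lt0r_neq0.
Qed.

Definition form_seminorm x : R := Num.sqrt (form_sqr x).

Lemma form_seminorm_ge0 x : 0 <= form_seminorm x.
Proof. exact: sqrtr_ge0. Qed.

Lemma form_seminorm_lincomb a x y :
  form_seminorm (a *: x + y) <=
    complex.Re `|a| * form_seminorm x + form_seminorm y.
Proof.
have na0 : 0 <= complex.Re `|a| by rewrite -ler0c -ge0_RRe.
have sx := form_seminorm_ge0 x; have sy := form_seminorm_ge0 y.
have s0 : 0 <= complex.Re `|a| * form_seminorm x + form_seminorm y.
  by rewrite addr_ge0 // mulr_ge0.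
rewrite /form_seminorm -[leRHS]ger0_norm // -sqrtr_sqr ler_sqrt ?sqr_ge0 //.
rewrite form_sqr_lincomb sqrrD exprMn !sqr_sqrtr ?form_sqr_ge0 //.
rewrite lerD2r lerD2l -[leRHS]mulr_natl ler_pM2l // -mulrA.
have ReM : complex.Re (a * f x y) <= complex.Re `|a| * complex.Re `|f x y|.
  rewrite -lecR rmorphM /= -(ge0_RRe (normr_ge0 a)).
  rewrite -(ge0_RRe (normr_ge0 (f x y))) -normrM.
  rewrite normc_def lecR (le_trans (ler_norm _)) // -sqrtr_sqr.
  by rewrite ler_sqrt ?addr_ge0 ?sqr_ge0 // lerDl sqr_ge0.
apply: le_trans ReM _; apply: ler_wpM2l => //.
have nf0 : 0 <= complex.Re `|f x y| by rewrite -ler0c -ge0_RRe.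
rewrite -sqrtrM ?form_sqr_ge0 // -[leLHS]ger0_norm //.
rewrite -sqrtr_sqr ler_sqrt ?mulr_ge0 ?form_sqr_ge0 //.
have := form_cauchy_schwarz x y.
by rewrite (ge0_RRe (normr_ge0 (f x y))) -rmorphXn lecR.
Qed.

Lemma form_seminormZ a x :
  form_seminorm (a *: x) = complex.Re `|a| * form_seminorm x.
Proof.
have f0 z : f 0 z = 0.
  by have := form_linl (-1) 0 0 z; rewrite scaler0 addr0 mulN1r addNr.
have sqr0 : form_sqr 0 = 0 by rewrite /form_sqr f0.
have na0 : 0 <= complex.Re `|a| by rewrite -ler0c -ge0_RRe.
have := form_sqr_lincomb a x 0; rewrite addr0 sqr0 addr0.
rewrite (positive_form_hermitian 0 x) f0 rmorph0 mulr0 /= mulr0 addr0 => sqrE.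
by rewrite /form_seminorm sqrE sqrtrM ?sqr_ge0 // sqrtr_sqr ger0_norm.
Qed.

End positive_form.

(** * The seminorm of a positive operator *)

Section hilbert_operators.
Context {R : realType} {H : completeNormedModType R[i]}.
Variable dot : {dot H for (@Num.conj R[i])}.
Hypothesis hdot : hilbert_dot dot.

Lemma dot_linl a x y z : dot (a *: x + y) z = a * dot x z + dot y z.
Proof. by rewrite linearPl. Qed.

Lemma dot_linr a x y z : dot x (a *: y + z) = Num.conj a * dot x y + dot x z.
Proof. by rewrite linearPr. Qed.

Lemma dot_ge0 x : 0 <= dot x x.
Proof. by rewrite -hdot exprn_ge0. Qed.

Lemma dot_le_norm x y : `|dot x y| <= `|x| * `|y|.
Proof.
have := form_cauchy_schwarz dot_linl dot_linr dot_ge0 x y.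
rewrite rmorphM /= -!(form_sqrE dot_ge0) -!hdot -exprMn.
by rewrite ler_pXn2r // nnegrE // mulr_ge0.
Qed.

Definition boundedA (A T : H -> H) (K : R) :=
  0 <= K /\ forall h, vnormA dot A (T h) <= K * vnormA dot A h.

Section positive_operator.
Context {A : H -> H}.
Hypothesis A_lin : linear A.
Hypothesis A_pos : positive_op dot A.
Local Notation f := (fun x y => dot (A x) y).

Let flinl a x y z : f (a *: x + y) z = a * f x z + f y z.
Proof. by rewrite /= A_lin dot_linl. Qed.
Let flinr a x y z : f x (a *: y + z) = Num.conj a * f x y + f x z.
Proof. exact: dot_linr. Qed.

Lemma vnormA_ge0 h : 0 <= vnormA dot A h.
Proof. exact: sqrtr_ge0. Qed.

Lemma vnormA_lincomb a x y : vnormA dot A (a *: x + y) <=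
  complex.Re `|a| * vnormA dot A x + vnormA dot A y.
Proof. exact: (form_seminorm_lincomb flinl flinr A_pos). Qed.

Lemma vnormAZ a x : vnormA dot A (a *: x) = complex.Re `|a| * vnormA dot A x.
Proof. exact: (form_seminormZ flinl flinr A_pos). Qed.

(** The supremum in [opnormA] only sees vectors of A-norm 1.  It still
    controls the vectors [h] of A-norm 0: when [g] has A-norm 1, so has
    [t h + g] for every [t], and boundedness of [T (t h + g)] in [t] makes the
    A-norm of [T h] vanish. *)
Lemma vnormA_boundedP T : linear T ->
  (opnormA dot A T < +oo)%E <-> exists K, boundedA A T K.
Proof.
move=> Tlin; split=> [|[K [K0 TK]]]; last first.
  apply: (@le_lt_trans _ _ K%:E); last exact: ltry.
  apply: ge_ereal_sup => _ [h /= h1 <-].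
  by rewrite lee_fin (le_trans (TK h)) // h1 mulr1.
move=> opT.
have [K K0 TK] : exists2 K, 0 <= K &
    forall h, vnormA dot A h = 1 -> vnormA dot A (T h) <= K.
  case E : (opnormA dot A T) opT => [r||] // _.
    exists (Num.max 0 r); first by rewrite le_max lexx.
    move=> h h1; rewrite le_max -[X in _ || X]lee_fin -E.
    by apply/orP; right; apply: ereal_sup_ubound; exists h.
  exists 0 => // h h1.
  have : ((vnormA dot A (T h))%:E <= -oo)%E.
    by rewrite -E; apply: ereal_sup_ubound; exists h.
  by rewrite leeNy_eq.
exists K; split=> // h; have [f fE] := linear_mapE Tlin; subst T.
have [h0|h0] := eqVneq (vnormA dot A h) 0; last first.
  have hgt0 : 0 < vnormA dot A h by rewrite lt_def h0 vnormA_ge0.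
  have n1 : complex.Re `|(vnormA dot A h)^-1%:C| = (vnormA dot A h)^-1.
    by rewrite norm_real_complex /= gtr0_norm // invr_gt0.
  have := TK ((vnormA dot A h)^-1%:C *: h).
  rewrite linearZ /= !vnormAZ n1 mulVf // => /(_ erefl).
  by rewrite ler_pdivrMl // mulrC.
rewrite h0 mulr0.
(* If no vector has A-norm 1, then the seminorm is zero. *)
case: (pselect (exists g, vnormA dot A g = 1)) => [[g g1]|no1]; last first.
  rewrite leNgt; apply/negP => Th0; apply: no1.
  exists ((vnormA dot A (f h))^-1%:C *: f h).
  rewrite vnormAZ norm_real_complex /= gtr0_norm ?invr_gt0 // mulVf //.
  exact: lt0r_neq0.
have gh1 (t : R) : vnormA dot A (t%:C *: h + g) = 1.
  apply/le_anti/andP; split.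
    by apply: le_trans (vnormA_lincomb _ _ _) _; rewrite h0 mulr0 add0r g1.
  have := vnormA_lincomb (- t%:C) h (t%:C *: h + g).
  by rewrite addrA -scalerDl addNr scale0r add0r g1 h0 mulr0 add0r.
have bnd (t : R) : 0 <= t -> t * vnormA dot A (f h) <= K + vnormA dot A (f g).
  move=> t0; have := vnormA_lincomb (-1) (f g) (f (t%:C *: h + g)).
  rewrite scaleN1r normrN1 mul1r linearD linearZ /= addrCA addNr addr0.
  rewrite vnormAZ norm_real_complex /= ger0_norm // => le1.
  have := TK _ (gh1 t); rewrite linearD linearZ /= => le2.
  by apply: le_trans le1 _; rewrite [leRHS]addrC lerD2l.
rewrite leNgt; apply/negP => Th0.
have := bnd ((K + vnormA dot A (f g) + 1) / vnormA dot A (f h)).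
rewrite divfK ?lt0r_neq0 // => /(_ _) le1.
suff : K + vnormA dot A (f g) + 1 <= K + vnormA dot A (f g) by lra.
by apply: le1; rewrite divr_ge0 ?(ltW Th0) // !addr_ge0 // vnormA_ge0.
Qed.

End positive_operator.
End hilbert_operators.

(** * Resolvents in a von Neumann algebra *)

Section von_neumann_algebra.
Context {R : realType} {H : completeNormedModType R[i]}.
Variable dot : {dot H for (@Num.conj R[i])}.
Hypothesis hdot : hilbert_dot dot.
Context {M : set (H -> H)}.
Hypothesis vnM : von_neumann dot M.

Lemma bounded_op_real (T : H -> H) : bounded_op T ->
  exists2 k : R, 0 <= k & forall h, `|T h| <= k%:C * `|h|.
Proof.
case=> _ [k Tk]; exists `|k| => // h; apply: le_trans (Tk h) _.
by rewrite ler_wpM2r // lecR ler_norm.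
Qed.

Lemma vN_op0 : M 0.
Proof.
have := vN_linear vnM (-1) (vN_id vnM) (vN_id vnM).
by rewrite scaleN1r addNr.
Qed.

(** The solution [x] of [l x - T x = h] is the fixed point of the contraction
    [g h : x |-> l^-1 (h + T x)].  As functions of [h], the iterates of [g h]
    from 0 are polynomials in [T], and they tend to the inverse of [l - T]. *)
Lemma resolvent_in T (k : R) (l : R[i]) : M T -> 0 <= k ->
  (forall h, `|T h| <= k%:C * `|h|) -> k%:C < `|l| ->
  inverse_in M (l *: (id : H -> H) - T).
Proof.
move=> MT k0 Tk kl.
have [f fE] := linear_mapE (vN_bounded vnM MT).1; subst T.
have l_gt0 : 0 < `|l| by apply: le_lt_trans kl; rewrite ler0c.
have l0 : l != 0 by rewrite -normr_gt0.
pose q := complex.Re `|l^-1| * k.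
have lV0 : 0 <= complex.Re `|l^-1| by rewrite -ler0c -ge0_RRe.
have q0 : 0 <= q by rewrite mulr_ge0.
have qE : q%:C = `|l|^-1 * k%:C.
  by rewrite -normfV (ge0_RRe (normr_ge0 l^-1)) -rmorphM.
have q1 : q < 1.
  by rewrite -ltcR qE mulrC ltr_pdivrMr // mul1r.
pose g h x := l^-1 *: (h + f x).
have gq h x y : `|g h x - g h y| <= q%:C * `|x - y|.
  rewrite -scalerBr opprD addrACA subrr add0r -linearB normrZ qE -mulrA normfV.
  by apply: ler_wpM2l; rewrite // invr_ge0 ltW.
have fixE h x : (g h x = x) <-> (l *: x - f x = h).
  split=> [gx|<-]; last by rewrite /g subrK scalerA mulVf // scale1r.
  by rewrite -{1}gx /g scalerA divff // scale1r addrK.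
have solve h : exists x, g h x = x by apply: contraction_fixpoint q0 q1 (gq h).
pose S h := sval (cid (solve h)).
have SE h : g h (S h) = S h by rewrite /S; case: cid.
have uniq h x : g h x = x -> x = S h.
  move=> gx; apply/eqP; rewrite -subr_eq0 -normr_eq0; apply: contraT => n0.
  have : `|x - S h| < `|x - S h|; last by rewrite ltxx.
  rewrite -{1}gx -{1}(SE h); apply: le_lt_trans (gq h _ _) _.
  by rewrite -[ltRHS]mul1r ltr_pM2r ?ltcR // lt_def n0 normr_ge0.
have lS h : l *: S h - f (S h) = h by apply/fixE.
have Sl h : S (l *: h - f h) = h by apply/esym/uniq/fixE.
have S_lin : linear S.
  move=> a x y; apply/esym/uniq/fixE.
  transitivity (a *: (l *: S x - f (S x)) + (l *: S y - f (S y))).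
    by rewrite [f (_ + _)]linearD [f (_ *: _)]linearZ /=
      scalerDr scalerBr !scalerA mulrC opprD addrACA.
  by rewrite !lS.
have le_S h : `|S h| <= (`|l| - k%:C)^-1 * `|h|.
  rewrite ler_pdivlMl ?subr_gt0 // mulrBl.
  rewrite -[leRHS](congr1 Num.norm (lS h)).
  apply: le_trans (lerB_dist _ _); rewrite normrZ lerD2l lerN2; exact: Tk.
exists S; last first.
  by split; apply/funext => h /=; [exact: lS|exact: Sl].
apply: (vN_closed vnM); split.
  split=> //; exists (complex.Re (`|l| - k%:C)^-1) => h.
  rewrite -ge0_RRe ?le_S // invr_ge0 subr_ge0 ltW //.
move=> n x y e e0.
pose b := \sum_i `|S (x i)| * `|y i|.
have b0 : 0 <= b by apply: sumr_ge0 => i _; rewrite mulr_ge0.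
have [N Ne] := expr_mul_small q0 q1 b0 e0.
exists (fun h => iter N (g h) 0).
  elim: N {Ne} => [|N IH] /=.
    exact: vN_op0.
  have -> : (fun h => g h (iter N (g h) 0)) =
      l^-1 *: (1 *: (id : H -> H) + (f \o (fun h => iter N (g h) 0))) + 0.
    by rewrite addr0 scale1r.
  apply: (vN_linear vnM); last exact: vN_op0.
  apply: (vN_linear vnM); first exact: (vN_id vnM).
  exact: (vN_comp vnM).
move=> i; apply: le_lt_trans Ne.
apply: le_trans (dot_le_norm hdot _ _) _.
(* S (x i) is a fixed point of the contraction whose iterates from 0 are the
   values at x i of the approximants. *)
have iterS m : iter m (g (x i)) (S (x i)) = S (x i).
  by elim: m => //= m ->.
rewrite -{1}(iterS N); apply: (@le_trans _ _ (q%:C ^+ N * `|S (x i)| * `|y i|)).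
  apply: ler_wpM2r => //.
  by have := iter_contraction q0 (gq (x i)) N (S (x i)) 0; rewrite subr0.
rewrite -mulrA; apply: ler_wpM2l; first by rewrite exprn_ge0 // ler0c.
rewrite /b (bigD1 i) //= lerDl; apply: sumr_ge0 => j _; exact: mulr_ge0.
Qed.

Context {A : H -> H}.
Hypothesis MA : M A.
Hypothesis A_pos : positive_op dot A.

Let A_lin : linear A. Proof. exact: (vN_bounded vnM MA).1. Qed.

Lemma algAP T : algA dot M A T <-> M T /\ exists K, boundedA dot A T K.
Proof.
split=> -[MT TA]; split=> //;
  by apply/(vnormA_boundedP A_lin A_pos (vN_bounded vnM MT).1).
Qed.

Lemma algA_operator_algebra : A <> 0 -> operator_algebra (algA dot M A).
Proof.
move=> A0; split.
- by move=> T [/(vN_bounded vnM)[]].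
- apply/algAP; split; first exact: (vN_id vnM).
  by exists 1; split=> // h; rewrite mul1r.
- move=> id0; apply: A0; apply/funext => h.
  by rewrite -[LHS]/((id : H -> H) (A h)) id0.
- move=> a T S /algAP[MT [K [K0 TK]]] /algAP[MS [L [L0 SL]]].
  apply/algAP; split; first exact: (vN_linear vnM).
  have a0 : 0 <= complex.Re `|a| by rewrite -ler0c -ge0_RRe.
  exists (complex.Re `|a| * K + L).
  split=> [|h]; first by rewrite addr_ge0 ?mulr_ge0.
  apply: le_trans (vnormA_lincomb A_lin A_pos _ _ _) _.
  by rewrite mulrDl lerD // -mulrA ler_wpM2l.
- move=> T S /algAP[MT [K [K0 TK]]] /algAP[MS [L [L0 SL]]].
  apply/algAP; split; first exact: (vN_comp vnM).
  exists (K * L); split=> [|h]; first exact: mulr_ge0.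
  by apply: le_trans (TK _) _; rewrite -mulrA ler_wpM2l.
Qed.

(** Beyond both the norm and the A-norm of [T] the inverse [S] of [l - T] in
    [M] is A-bounded, because [l S h = h + T S h] gives
    [(|l| - K) ||S h||_A <= ||h||_A]. *)
Lemma bounded_spectrum_algA T : algA dot M A T -> exists K : R[i],
  forall l, ~ (`|l| <= K) -> inverse_in (algA dot M A) (l *: (id : H -> H) - T).
Proof.
move=> /algAP[MT [K [K0 TK]]].
have [k k0 Tk] := bounded_op_real (vN_bounded vnM MT).
exists (Num.max k K)%:C => l.
have lE := ge0_RRe (normr_ge0 l); rewrite {1}lE lecR.
set r := complex.Re _ in lE *; move/negP; rewrite -ltNge gt_max => /andP[kr Kr].
have [|S MS [lS Sl]] := @resolvent_in T k l MT k0 Tk; first by rewrite lE ltcR.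
exists S => //; apply/algAP; split=> //.
exists (r - K)^-1; split=> [|h]; first by rewrite invr_ge0 subr_ge0 ltW.
rewrite ler_pdivlMl ?subr_gt0 // mulrBl lerBlDr.
have /(congr1 (fun g => g h)) /= lSh := lS.
have := vnormA_lincomb A_lin A_pos 1 h (T (S h)).
rewrite -{1}lSh scale1r.
have -> : (l *: (id : H -> H) - T) (S h) + T (S h) = l *: S h.
  by rewrite -[(l *: _ - _) _]/(l *: S h - T (S h)) subrK.
rewrite (vnormAZ A_lin A_pos) -/r normr1 mul1r => le1.
by apply: le_trans le1 _; rewrite lerD2l TK.
Qed.

End von_neumann_algebra.

(** * Central positive operators *)

(** If [b 0 > a r], the recursion makes [b n] at least [a t^(2^n)] with
    [t = b 0 / a > r], too large for the bound [r^(2^n) C]. *)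
Lemma reid_sequence (R : realType) (b : nat -> R) (a r C : R) :
  0 <= a -> 0 < r -> (forall n, 0 <= b n) ->
  (forall n, b n ^+ 2 <= a * b n.+1) -> (forall n, b n <= r ^+ (2 ^ n) * C) ->
  b 0%N <= a * r.
Proof.
move=> a0 r0 b0 b_step b_le; rewrite leNgt; apply/negP => ar_lt.
have a_gt0 : 0 < a.
  rewrite lt_def a0 andbT; apply: contraTneq ar_lt => a00.
  rewrite a00 mul0r -leNgt.
  have := b_step 0%N; rewrite a00 mul0r => b00.
  by rewrite leNgt; apply/negP => bp; move: b00; rewrite leNgt exprn_gt0.
have b00 : 0 < b 0%N by apply: le_lt_trans ar_lt; rewrite mulr_ge0 // ltW.
have b_ge n : a * (b 0%N / a) ^+ (2 ^ n) <= b n.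
  elim: n => [|n IH]; first by rewrite expn0 expr1 mulrC divfK ?lt0r_neq0.
  rewrite -(ler_pM2l a_gt0); apply: le_trans (b_step n).
  rewrite mulrA -expr2 expnSr exprM -exprMn.
  have t0 : 0 <= a * (b 0%N / a) ^+ (2 ^ n).
    by rewrite mulr_ge0 ?exprn_ge0 ?divr_ge0.
  by apply: lerXn2r; rewrite ?nnegrE.
pose q := a * r / b 0%N.
have q0 : 0 <= q by rewrite !mulr_ge0 // ?invr_ge0 ltW.
have q1 : q < 1 by rewrite ltr_pdivrMr // mul1r.
have C0 : 0 <= C.
  by have := le_trans (b0 0%N) (b_le 0%N); rewrite pmulr_rge0 // exprn_gt0.
have [N qN] := expr_mul_small_real C q0 q1 a_gt0.
have : a < a; last by rewrite ltxx.
apply: le_lt_trans qN; apply: (@le_trans _ _ (q ^+ (2 ^ N) * C)); last first.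
  apply: ler_wpM2r => //; apply: ler_wiXn2l; rewrite ?(ltW q1) //.
  exact/ltnW/ltn_expl.
have tN : 0 < (b 0%N / a) ^+ (2 ^ N) by rewrite exprn_gt0 // divr_gt0.
rewrite -(ler_pM2r tN) mulrAC -exprMn.
have -> : q * (b 0%N / a) = r by rewrite /q; field; rewrite !lt0r_neq0.
exact: le_trans (b_ge N) (b_le N).
Qed.

Section central_operator.
Context {R : realType} {H : completeNormedModType R[i]}.
Variable dot : {dot H for (@Num.conj R[i])}.
Hypothesis hdot : hilbert_dot dot.
Context {M : set (H -> H)}.
Hypothesis vnM : von_neumann dot M.
Context {A : H -> H}.
Hypothesis A_pos : positive_op dot A.
Hypothesis A_central : central M A.

Let f x y := dot (A x) y.
Let A_lin : linear A. Proof. exact: (vN_bounded vnM A_central.1).1. Qed.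
Let flinl a x y z : f (a *: x + y) z = a * f x z + f y z.
Proof. by rewrite /f A_lin dot_linl. Qed.
Let flinr a x y z : f x (a *: y + z) = Num.conj a * f x y + f x z.
Proof. exact: dot_linr. Qed.
Let fge0 x : 0 <= f x x. Proof. exact: A_pos. Qed.
Local Notation sq := (form_sqr f).

(** Since [A] commutes with [T], [<A T h, T h> = <A h, S T h>], to which the
    Cauchy-Schwarz inequality for the form of [A] applies. *)
Lemma central_adjoint_sqr T S h : M T -> is_adjoint dot T S ->
  sq (T h) ^+ 2 <= sq h * sq (S (T h)).
Proof.
move=> MT TS; rewrite -lecR rmorphXn /=.
have fE : f h (S (T h)) = (sq (T h))%:C.
  rewrite -(form_sqrE fge0) /f -TS.
  by have /(congr1 (fun g => g h)) /= -> := A_central.2 _ MT.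
have := form_cauchy_schwarz flinl flinr fge0 h (S (T h)).
by rewrite fE norm_real_complex ger0_norm // (form_sqr_ge0 fge0).
Qed.

Lemma form_sqr_bound : exists2 k : R, 0 <= k &
  forall h, sq h <= k * complex.Re `|h| ^+ 2.
Proof.
have [k k0 Ak] := bounded_op_real (vN_bounded vnM A_central.1).
exists k => // h; rewrite -lecR -(form_sqrE fge0).
rewrite rmorphM rmorphXn /= -(ge0_RRe (normr_ge0 h)).
rewrite -[leLHS]ger0_norm //; apply: le_trans (dot_le_norm hdot _ _) _.
by rewrite expr2 mulrA ler_wpM2r.
Qed.

(** Reid's inequality for the self-adjoint operators [X n = (T^* T)^(2^n)]. *)
Lemma central_boundedA T : M T -> exists K, boundedA dot A T K.
Proof.
move=> MT; have [S MS TS] := vN_adjoint vnM MT.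
pose X n := iter n (fun Y => Y \o Y) (S \o T).
have MX n : M (X n).
  by elim: n => [|n IH] /=; exact: (vN_comp vnM).
have [k k0 Xk] := bounded_op_real (vN_bounded vnM (MX 0%N)).
(* Adding 1 makes K positive, and at least 1 for the last estimate. *)
pose K := k + 1.
have K0 : 0 < K by rewrite ltr_wpDl.
have XK n h : complex.Re `|X n h| <= K ^+ (2 ^ n) * complex.Re `|h|.
  elim: n h => [|n IH] h.
    rewrite expn0 expr1 -lecR rmorphM /= -!(ge0_RRe (normr_ge0 _)).
    apply: le_trans (Xk h) _; rewrite ler_wpM2r // lecR /K; lra.
  rewrite expnS mul2n -addnn exprD -mulrA; apply: le_trans (IH _) _.
  by rewrite ler_wpM2l // exprn_ge0 // ltW.
have X_adj n : is_adjoint dot (X n) (X n).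
  elim: n => [|n IH] x y; last by rewrite /= !IH.
  have herm :=
    positive_form_hermitian (dot_linl dot) (dot_linr dot) (dot_ge0 hdot).
  by rewrite /X /= -TS herm -TS -herm.
exists K; split=> [|h]; first exact: ltW.
have [c c0 sqc] := form_sqr_bound.
have sq0 x : 0 <= sq x by exact: (form_sqr_ge0 fge0).
have sqX : sq (X 0%N h) <= sq h * K ^+ 2.
  apply: (reid_sequence (b := fun n => sq (X n h))
    (C := c * complex.Re `|h| ^+ 2)) => //.
  - by rewrite exprn_gt0.
  - by move=> n; apply: (central_adjoint_sqr h (MX n) (X_adj n)).
  - move=> n; apply: le_trans (sqc _) _.
    rewrite [leRHS]mulrCA; apply: ler_wpM2l => //.
    rewrite -exprM mulnC exprM -exprMn; apply: lerXn2r; rewrite ?XK // nnegrE.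
      by rewrite -ler0c -ge0_RRe.
    by rewrite mulr_ge0 ?exprn_ge0 ?(ltW K0) // -ler0c -ge0_RRe.
have sqT : sq (T h) <= K ^+ 2 * sq h.
  have K1 : 1 <= K ^+ 2 by rewrite exprn_ege1 // /K; lra.
  have K20 : 0 <= K ^+ 2 by rewrite exprn_ge0 // ltW.
  have Ksq0 : 0 <= K ^+ 2 * sq h by apply: mulr_ge0.
  rewrite -(ler_pXn2r (n := 2)) // ?nnegrE //.
  apply: le_trans (central_adjoint_sqr h MT TS) _.
  apply: (@le_trans _ _ (sq h * (sq h * K ^+ 2))); first exact: ler_wpM2l.
  rewrite exprMn mulrA -expr2 mulrC; apply: ler_wpM2r; first exact: sqr_ge0.
  by rewrite [leRHS]expr2 ler_peMl.
have -> : K = Num.sqrt (K ^+ 2) by rewrite sqrtr_sqr gtr0_norm.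
rewrite /vnormA -sqrtrM ?sqr_ge0 // ler_sqrt; first exact: sqT.
by apply: mulr_ge0; [exact: sqr_ge0 | exact: sq0].
Qed.

End central_operator.

Lemma opnorm_ltP (R : realType) (H : completeNormedModType R[i]) (T : H -> H)
    (d : R) : linear T -> 0 <= d -> (opnorm T < d%:E)%E ->
  forall h, `|T h| <= d%:C * `|h|.
Proof.
move=> Tlin d0 Td h; have [f fE] := linear_mapE Tlin; subst T.
have [->|h0] := eqVneq h 0; first by rewrite linear0 !normr0 mulr0.
have hn : 0 < `|h| by rewrite normr_gt0.
have n1 : `|(`|h|^-1 *: h)| = 1.
  by rewrite normrZ normfV normr_id mulVf // gt_eqF.
have : ((complex.Re `|f (`|h|^-1 *: h)|)%:E <= opnorm f)%E.
  by apply: ereal_sup_ubound; exists (`|h|^-1 *: h).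
move=> /le_lt_trans /(_ Td); rewrite lte_fin => /ltW.
rewrite -lecR -(ge0_RRe (normr_ge0 _)) linearZ /= normrZ normfV normr_id.
by rewrite ler_pdivrMl // mulrC.
Qed.

(** * Multiplicativity *)

Unset Implicit Arguments.

Theorem theorem3p7 (R : realType) (H : completeNormedModType R[i])
  (dot : {dot H for (@Num.conj R[i])}) (hdot : hilbert_dot dot)
  (M : set (H -> H)) (vnM : von_neumann dot M)
  (A : H -> H) (MA : M A) (A_neq0 : A <> 0) (A_pos : positive_op dot A)
  (phi : (H -> H) -> R[i]) (phi_lin : linear_on (algA dot M A) phi)
  (phi_spec : forall T : H -> H, algA dot M A T ->
     spectrumA dot M A T (phi T)) :
  (forall T S : H -> H, algA dot M A T -> algA dot M A S ->
     phi (T \o S) = phi T * phi S) /\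
  (central M A -> character M phi).
Proof.
have not_inverse T : algA dot M A T ->
    ~ inverse_in (algA dot M A) (phi T *: (id : H -> H) - T).
  move=> /phi_spec Tspec [S ES [TS ST]]; apply: Tspec; exists S => //.
  by split; [have := congr1 (comp A) TS | have := congr1 (comp A) ST].
have phi_mul : forall T S, algA dot M A T -> algA dot M A S ->
    phi (T \o S) = phi T * phi S.
  apply: gkz_operators => //.
  - exact: (algA_operator_algebra vnM MA A_pos A_neq0).
  - by move=> T; exact: (bounded_spectrum_algA hdot vnM MA A_pos).
split=> // A_central.
have algAE T : M T -> algA dot M A T.
  move=> MT; apply/(algAP vnM MA A_pos); split=> //.
  exact: (central_boundedA hdot vnM A_pos A_central).
split.
- by move=> a T S MT MS; apply: phi_lin; exact: algAE.
- by move=> T S MT MS; apply: phi_mul; exact: algAE.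
(* Were |phi (S - T)| at least e, it would exceed the norm of S - T, and
   phi (S - T) would lie outside the spectrum of S - T. *)
move=> T MT e e0; exists (e / 2) => [|S MS dST]; first by rewrite divr_gt0.
have e20 : 0 <= e / 2 by rewrite divr_ge0 // ltW.
have phiB : phi (S - T) = phi S - phi T.
  rewrite addrC -scaleN1r phi_lin; [by rewrite mulN1r addrC|exact: algAE..].
have MST : M (S - T).
  by rewrite addrC -scaleN1r; apply: (vN_linear vnM).
have bnd := opnorm_ltP (vN_bounded vnM MST).1 e20 dST.
rewrite -phiB (ge0_RRe (normr_ge0 _)) ltcR ltNge; apply/negP => e_le.
apply: (not_inverse _ (algAE _ MST)).
have [|U MU UE] := resolvent_in hdot vnM MST e20 bnd (l := phi (S - T)).
  rewrite [ltRHS](ge0_RRe (normr_ge0 _)) ltcR; apply: lt_le_trans e_le.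
  by rewrite ltr_pdivrMr // ltr_pMr // ltr1n.
by exists U => //; apply: algAE.
Qed.
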